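(* Given a parameter $R>0$, set $\varepsilon_r\leftarrow\varepsilon^{r/R}$ for all $r\ge1$ in the algorithm Multi-Round $\varepsilon$-Arm (described in the context), run by $k$ players with input $(\varepsilon,\delta)$. With probability at least $1-\delta$, the modified algorithm (1) identifies an $\varepsilon$-best arm using $$\tilde O\left(\frac{\varepsilon^{-2/R}}{k}\cdot\sum_{i=2}^n\frac1{(\Delta_i^\varepsilon)^2}\right)$$ arm pulls per player; (2) terminates after at most $R$ rounds of communication.
   Context: There are $k\ge1$ players and $n$ arms. Each pull of arm $i$ by a player yields an independent sample of a $[0,1]$-valued reward with unknown expectation $p_i$. For convenience of notation, arms are ordered so that $p_1\ge p_2\ge\dots\ge p_n$ (the players do not know this order). $\Delta_i:=p_1-p_i$ and $\Delta_i^\varepsilon:=\max\{\Delta_i,\varepsilon\}$. An arm $i$ is $\varepsilon$-best (or $\varepsilon$-optimal) if $p_i\ge p_1-\varepsilon$. In a communication round each player broadcasts a message to all other players. $\tilde O$ hides polylogarithmic factors in $n,k,\varepsilon,\delta$ and $\Delta_2,\dots,\Delta_n$. Algorithm Multi-Round $\varepsilon$-Arm with input $(\varepsilon,\delta)$, in its original form with $\varepsilon_r=2^{-r}$ (the modification replaces this by $\varepsilon_r=\varepsilon^{r/R}$): initialize $S_0=[n]$, $r=0$, $t_0=0$. Repeat: set $r\leftarrow r+1$; let $t_r=\frac{2}{k\varepsilon_r^2}\ln\frac{4nr^2}{\delta}$. Each player $j=1,\dots,k$ samples each arm $i\in S_{r-1}$ for $t_r-t_{r-1}$ times, lets $\hat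 p^{\,r}_{j,i}$ be the average reward of arm $i$ in all rounds so far of player $j$, and communicates the numbers $\hat p^{\,r}_{j,1},\dots,\hat p^{\,r}_{j,n}$ (one communication round). Let $\hat p_i^{\,r}=\frac1k\sum_{j=1}^k\hat p^{\,r}_{j,i}$ for $i\in S_{r-1}$ and $\hat p_\star^{\,r}=\max_{i\in S_{r-1}}\hat p_i^{\,r}$; set $S_r=S_{r-1}\setminus\{i\in S_{r-1}:\hat p_i^{\,r}<\hat p_\star^{\,r}-\varepsilon_r\}$. Stop when $\varepsilon_r\le\varepsilon/2$ or $|S_r|=1$, and return an arm from $S_r$.
   Formalization: R is a positive integer, 0<ε<1, 0<δ<1, n≥2; (2) is shown when stopping at ε_r≤ε and returning the top empirical arm; the original ε/2 stop gets ⌈R(1+ln 2/ln(1/ε))⌉ rounds; Õ also hides 1+ln(round bound); up to n extra pulls if t_1<1. *)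

(* Defs.v *)
From HB Require Import structures.
From mathcomp Require Import all_boot all_order all_algebra.
From mathcomp Require Import all_classical all_reals all_analysis.

Set Implicit Arguments.
Unset Strict Implicit.
Unset Printing Implicit Defensive.

Import Order.TTheory GRing.Theory Num.Theory.
Import numFieldNormedType.Exports.

Local Open Scope classical_set_scope.
Local Open Scope ring_scope.

(** * Rewards *)

(* Product rule over every finite subfamily. *)
Definition mutually_independent (dT : measure_display) (T : measurableType dT)
    (R : realType) (P : probability T R) (I : eqType)
    (X : I -> {RV P >-> R}) : Prop :=
  forall (s : seq I) (B : I -> set R),
    uniq s -> (forall a, measurable (B a)) ->
    P (\bigcap_(a in [set` s]) (X a @^-1` B a))
    = (\prod_(a <- s) P (X a @^-1` B a))%E.

(* [X (j, i, s)] is the reward of the [s]-th pull (from 0) of arm [i] by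
   player [j]; [p i] is the expected reward of arm [i]. *)
Record reward_model (dT : measure_display) (T : measurableType dT)
    (R : realType) (P : probability T R) (k n : nat) (p : 'I_n -> R)
    (X : 'I_k * 'I_n * nat -> {RV P >-> R}) : Prop := RewardModel {
  reward_range : forall a w, 0 <= X a w <= 1;
  reward_mean : forall j i s, ('E_P[X (j, i, s)] = (p i)%:E)%E;
  reward_law : forall j i s j' s' (B : set R), measurable B ->
    P (X (j, i, s) @^-1` B) = P (X (j', i, s') @^-1` B);
  reward_indep : mutually_independent X }.

(* "With probability at least 1 - delta"; the inner formulation makes sense
   without a measurability assumption on the rule choosing the returned arm. *)
Definition with_prob_ge (dT : measure_display) (T : measurableType dT)
    (R : realType) (P : probability T R) (c : R) (E : T -> Prop) : Prop :=
  exists A : set T,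
    [/\ measurable A, (forall w, A w -> E w) & (c%:E <= P A)%E].

(** * The algorithm

   It is a deterministic function of the reward table
   [x : 'I_k -> 'I_n -> nat -> R].  The accuracies [e r] (epsilon_r) and the
   accuracy [theta] at which the loop stops are parameters; rounds are numbered
   from 1, and there is one round of communication in each of them. *)

(* t_r *)
Definition budget (R : realType) (k n : nat) (delta : R) (e : nat -> R)
    (r : nat) : R :=
  if r == 0%N then 0
  else 2 / (k%:R * e r ^+ 2) * ln (4 * n%:R * r%:R ^+ 2 / delta).

(* t_r rounded up: the number of times each player has sampled, by the end of
   round [r], an arm that is still present in that round. *)
Definition nsamples (R : realType) (k n : nat) (delta : R) (e : nat -> R)
    (r : nat) : nat :=
  `|Num.ceil (budget k n delta e r)|%N.

(* The average reward of arm [i] for player [j] over rounds 1, ..., r.  It is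
   only used for arms still present in round [r]. *)
Definition player_mean (R : realType) (k n : nat) (delta : R) (e : nat -> R)
    (x : 'I_k -> 'I_n -> nat -> R) (r : nat) (j : 'I_k) (i : 'I_n) : R :=
  (\sum_(s < nsamples k n delta e r) x j i s) / (nsamples k n delta e r)%:R.

Definition pooled_mean (R : realType) (k n : nat) (delta : R) (e : nat -> R)
    (x : 'I_k -> 'I_n -> nat -> R) (r : nat) (i : 'I_n) : R :=
  (\sum_(j < k) player_mean delta e x r j i) / k%:R.

(* The default value 0 is harmless: rewards are nonnegative. *)
Definition best_mean (R : realType) (k n : nat) (delta : R) (e : nat -> R)
    (x : 'I_k -> 'I_n -> nat -> R) (r : nat) (S : {set 'I_n}) : R :=
  \big[Num.max/0]_(i in S) pooled_mean delta e x r i.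

(* S_r *)
Fixpoint survivors (R : realType) (k n : nat) (delta : R) (e : nat -> R)
    (x : 'I_k -> 'I_n -> nat -> R) (r : nat) : {set 'I_n} :=
  if r is q.+1 then
    let S := survivors delta e x q in
    S :\: [set i in S |
            pooled_mean delta e x r i < best_mean delta e x r S - e r]%SET
  else [set: 'I_n]%SET.

Definition stop_test (R : realType) (k n : nat) (delta : R) (e : nat -> R)
    (theta : R) (x : 'I_k -> 'I_n -> nat -> R) (r : nat) : bool :=
  (e r <= theta) || (#|survivors delta e x r| == 1%N).

(* [r] is the number of rounds performed; at least one round is. *)
Definition stops_after (R : realType) (k n : nat) (delta : R) (e : nat -> R)
    (theta : R) (x : 'I_k -> 'I_n -> nat -> R) (r : nat) : Prop :=
  [/\ (0 < r)%N, stop_test delta e theta x r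
    & forall q, (0 < q < r)%N -> ~~ stop_test delta e theta x q].

(* Number of pulls made by each player in [r] rounds. *)
Definition pulls_per_player (R : realType) (k n : nat) (delta : R)
    (e : nat -> R) (x : 'I_k -> 'I_n -> nat -> R) (r : nat) : nat :=
  (\sum_(1 <= q < r.+1) \sum_(i in survivors delta e x q.-1)
     (nsamples k n delta e q - nsamples k n delta e q.-1))%N.

(* Rules choosing the returned arm from the last set of surviving arms and the
   last pooled means: any arm of the set, or one with the largest mean. *)
Definition returns_survivor (R : realType) (n : nat)
    (ret : {set 'I_n} -> ('I_n -> R) -> 'I_n) : Prop :=
  forall S q, S != finset.set0 -> ret S q \in S.

Definition returns_top_survivor (R : realType) (n : nat)
    (ret : {set 'I_n} -> ('I_n -> R) -> 'I_n) : Prop :=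
  forall S q, S != finset.set0 ->
    ret S q \in S /\ (forall i, i \in S -> q i <= q (ret S q)).

(** * The guarantee *)

(* epsilon_r = epsilon^(r/N), where N is the parameter called R on paper. *)
Definition root_schedule (R : realType) (eps : R) (N r : nat) : R :=
  eps `^ (r%:R / N%:R).

(* [a1] is the first (best) arm. *)
Definition gap (R : realType) (n : nat) (p : 'I_n -> R) (a1 i : 'I_n) : R :=
  p a1 - p i.

Definition eps_gap (R : realType) (n : nat) (p : 'I_n -> R) (a1 : 'I_n)
    (eps : R) (i : 'I_n) : R :=
  Num.max (gap p a1 i) eps.

Definition eps_best (R : realType) (n : nat) (p : 'I_n -> R) (a1 : 'I_n)
    (eps : R) (i : 'I_n) : Prop :=
  p a1 - eps <= p i.

(* What the O~ hides.  No logarithm of a gap is needed: the gaps enter only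
   through eps_gap, which lies between epsilon and 1. *)
Definition polylog (R : realType) (C : R) (d k n : nat) (eps delta : R) : R :=
  C * (1 + ln n%:R + ln k%:R + ln eps^-1 + ln delta^-1) ^+ d.

(* The summation over [i != a1] is the one over i = 2, ..., n. *)
Definition complexity (R : realType) (k n : nat) (p : 'I_n -> R) (a1 : 'I_n)
    (eps : R) (N : nat) : R :=
  eps `^ (- (2 / N%:R)) / k%:R * \sum_(i < n | i != a1) (eps_gap p a1 eps i) ^- 2.

(* A run on table [x]: it stops after at most [rounds] rounds, its output is
   epsilon-best, and each player makes at most [pulls] pulls.  As a pull is
   indivisible, this last bound can only hold up to one pull per arm when the
   prescribed t_1 is less than one pull. *)
Definition good_run (R : realType) (k n : nat) (p : 'I_n -> R) (a1 : 'I_n)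
    (eps delta : R) (e : nat -> R) (theta : R)
    (ret : {set 'I_n} -> ('I_n -> R) -> 'I_n) (rounds pulls : R)
    (x : 'I_k -> 'I_n -> nat -> R) : Prop :=
  exists r : nat,
    [/\ stops_after delta e theta x r,
        eps_best p a1 eps
          (ret (survivors delta e x r) (pooled_mean delta e x r)),
        (pulls_per_player delta e x r)%:R <= pulls + n%:R,
        (1 <= budget k n delta e 1 ->
           (pulls_per_player delta e x r)%:R <= pulls)
      & r%:R <= rounds].

(* Main.v *)
(* Hoeffding's inequality, with the sharp constant, for the k t_r pooled samples
   of an arm gives |phat_i^r - p_i| <= e_r / 2 outside an event of probability
   at most delta / (2 n r^2), hence simultaneously for all arms and rounds with
   probability at least 1 - delta.  On that event the best arm is never
   eliminated and an arm surviving round q has gap at most 2 e_q.  An arm present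
   in round q + 1 thus satisfies eps_gap <= 2 e_q = 2 eps^(-1/N) e_{q+1}, so its
   t_{q+1} pulls cost O(eps^(-2/N) / (k eps_gap^2)) up to a logarithm; the best
   arm is charged to a rival which is still present in the last round. *)
Require Import Defs.
From HB Require Import structures.
From mathcomp Require Import all_boot all_order all_algebra.
From mathcomp Require Import all_classical all_reals all_analysis.
From mathcomp Require Import measurable_realfun ring lra.

Set Implicit Arguments.
Unset Strict Implicit.
Unset Printing Implicit Defensive.

Import Order.TTheory GRing.Theory Num.Theory.
Import numFieldNormedType.Exports.

Local Open Scope classical_set_scope.
Local Open Scope ring_scope.

(** * Hoeffding's inequality *)

Lemma ge0_derive_ge0 (R : realType) (f df : R -> R) (l : R) :
  (forall x : R, 0 <= x -> is_derive x (1 : R) f (df x)) ->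
  (forall x, 0 <= x -> 0 <= df x) -> 0 <= l -> f 0 <= f l.
Proof.
move=> fdf df0 l0; have [x|c|c] := @MVT_segment R f df 0 l l0.
- by rewrite in_itv/= => /andP[/ltW x0 _]; exact: fdf.
- apply: derivable_within_continuous => x; rewrite in_itv/= => /andP[x0 _].
  exact: (@ex_derive _ _ _ _ _ _ _ (fdf x x0)).
rewrite in_itv/= subr0 => /andP[/df0 c0 _] fl.
by rewrite -subr_ge0 fl mulr_ge0.
Qed.

(** * Hoeffding's lemma for a Bernoulli variable *)

Section hoeffding_lemma.
Variables (R : realType) (p : R).
Hypothesis p01 : 0 <= p <= 1.

(** Moment generating function of a Bernoulli variable of mean [p]. *)
Let D (x : R) : R := 1 - p + p * expR x.

Let D_gt0 (x : R) : 0 <= x -> 0 < D x.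
Proof.
move=> x0; have ex1 : 1 <= expR x by rewrite -expR0 ler_expR.
case/andP: p01 => p0 p1; rewrite (@lt_le_trans _ _ 1)// /D.
by have := ler_wpM2l p0 ex1; lra.
Qed.

Let is_derive_D (x : R) : is_derive x (1 : R) D (p * expR x).
Proof. by apply: is_derive_eq; rewrite /GRing.scale/= add0r mul1r. Qed.

(** The left side is the logarithmic derivative of [D]. It equals [p] at 0, and its own derivative
    is [u * (1 - u)] with [u = p * expR x / D x], hence at most 1/4. *)
Let ratio_le (x : R) : 0 <= x -> p * expR x / D x <= x / 4 + p.
Proof.
move=> x0.
pose G (y : R) : R := y / 4 + p - p * expR y / D y.
have G0 : G 0 = 0.
  by rewrite /G /D expR0 !mulr1 subrK divr1 mul0r add0r subrr.
have dG (y : R) : 0 <= y ->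
    is_derive y (1 : R) G (4^-1 - p * (1 - p) * expR y / D y ^+ 2).
  move=> y0; have Dy : D y != 0 by rewrite gt_eqF// D_gt0.
  have ? := is_derive_D y.
  have ? : is_derive y (1 : R) (fun z => (D z)^-1) (- (D y) ^- 2 * (p * expR y)).
    exact: is_deriveV.
  rewrite /G; apply: is_derive_eq.
  rewrite /GRing.scale/=.
  by move: Dy; rewrite /D; move: (expR y) => E Dy; field.
suff : G 0 <= G x by rewrite G0 subr_ge0.
apply: (ge0_derive_ge0 dG) => // y y0.
have Dy := D_gt0 y0.
rewrite subr_ge0 ler_pdivrMr ?exprn_gt0// ler_pdivlMl//.
rewrite -subr_ge0 (_ : _ - _ = (1 - p - p * expR y) ^+ 2) ?sqr_ge0//.
by rewrite /D; ring.
Qed.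

(** Integrating [ratio_le] from 0, where [ln (D 0) = 0], bounds [ln (D l)]. *)
Lemma bernoulli_mgf_le (l : R) : 0 <= l ->
  1 + (expR l - 1) * p <= expR (l * p + l ^+ 2 / 8).
Proof.
move=> l0; have -> : 1 + (expR l - 1) * p = D l by rewrite /D; ring.
pose F (y : R) : R := y * p + y ^+ 2 / 8 - ln (D y).
have F0 : F 0 = 0.
  by rewrite /F /D expR0 mulr1 subrK ln1 expr0n/= !mul0r addr0 subrr.
have dF (y : R) : 0 <= y ->
    is_derive y (1 : R) F (y / 4 + p - p * expR y / D y).
  move=> y0; have ? := is_derive_D y.
  have ? : is_derive y (1 : R) (fun z => ln (D z)) ((D y)^-1 * (p * expR y)).
    have ? := is_derive1_ln (D_gt0 y0).
    exact: is_derive1_comp.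
  rewrite /F; apply: is_derive_eq.
  have : D y != 0 by rewrite gt_eqF// D_gt0.
  by rewrite /GRing.scale/=; move: (D y) (expR y) => d E d0; field.
suff : F 0 <= F l.
  by rewrite F0 subr_ge0 => Fl; rewrite -[X in X <= _]lnK ?posrE ?D_gt0// ler_expR.
apply: (ge0_derive_ge0 dF) => // y y0.
by rewrite subr_ge0 ratio_le.
Qed.

End hoeffding_lemma.

(** * Expectation of a product with an independent factor *)

Section independence.
Context (dT : measure_display) (T : measurableType dT) (R : realType)
  (P : probability T R).
Local Open Scope ereal_scope.
Import HBNNSimple.

(** The last hypothesis is the claim for indicators of events of [W]. It extends to simple functions
    of [W] by linearity, then to [W] by monotone convergence. *)
Lemma integral_mul_indep (Q W : T -> R) :
  measurable_fun setT Q -> measurable_fun setT W ->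
  (forall w, 0 <= Q w)%R -> (forall w, 0 <= W w)%R ->
  \int[P]_w (Q w)%:E \is a fin_num ->
  (forall B, measurable B -> \int[P]_w (Q w * \1_B (W w))%:E =
    (\int[P]_w (Q w)%:E) * P (W @^-1` B)) ->
  \int[P]_w (Q w * W w)%:E = (\int[P]_w (Q w)%:E) * \int[P]_w (W w)%:E.
Proof.
move=> mQ mW Q0 W0 EQfin QW.
have mW' B : measurable B -> measurable (W @^-1` B).
  by move=> mB; rewrite -[_ @^-1` _]setTI; exact: mW.
(* The identity on the nonnegative reals is approximated, rather than [W] itself: the level sets of
   [g n] composed with [W] are then preimages under [W] of measurable sets of reals, as the
   hypothesis requires. *)
pose D : set R := `[0%R, +oo[%classic.
have mD : measurable D by exact: measurable_itv.
have mid : measurable_fun D (@EFin R) by exact: measurable_funTS.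
pose g := nnsfun_approx mD mid.
have mgW n : measurable_fun setT (fun w => g n (W w)) by exact: measurableT_comp.
have gW n : \int[P]_w (Q w * g n (W w))%:E =
    (\int[P]_w (Q w)%:E) * \int[P]_w (g n (W w))%:E.
  have mind r : measurable_fun setT (fun w => \1_(g n @^-1` [set r]) (W w) : R).
    exact: measurableT_comp.
  have E1 : \int[P]_w (g n (W w))%:E =
      \sum_(r \in range (g n)) r%:E * P (W @^-1` (g n @^-1` [set r])).
    under eq_integral do rewrite fimfunE -fsumEFin//.
    rewrite ge0_integral_fsum//; last 2 first.
      - move=> r; apply/measurable_EFinP; exact: measurable_funM.
      - by move=> r w _; rewrite EFinM nnfun_muleindic_ge0.
    apply: eq_fsbigr => r; rewrite inE => -[y _ <-].
    under eq_integral do rewrite EFinM.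
    rewrite ge0_integralZl//; last 2 first.
      - exact/measurable_EFinP.
      - by rewrite lee_fin.
    congr (_ * _); rewrite -(setIT (W @^-1` _)) -integral_indic//.
    exact: mW'.
  rewrite E1 ge0_mule_fsumr; last first.
    (* A negative [r] is not a value of [g n], so its term vanishes. *)
    move=> r; have [r0|r0] := ltP r 0%R; last by rewrite mule_ge0.
    by rewrite preimage_nnfun0// preimage_set0 measure0 mule0.
  have Qg w : (Q w * g n (W w))%:E =
      \sum_(r \in range (g n)) (r%:E * (Q w * \1_(g n @^-1` [set r]) (W w))%:E).
    rewrite EFinM fimfunE -fsumEFin// ge0_mule_fsumr.
      by apply: eq_fsbigr => r _; rewrite -!EFinM mulrCA.
    by move=> r; rewrite EFinM nnfun_muleindic_ge0.
  under eq_integral do rewrite Qg.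
  rewrite ge0_integral_fsum//; last 2 first.
    - move=> r; apply/measurable_EFinP.
      by apply: measurable_funM => //; exact: measurable_funM.
    - move=> r w _; rewrite EFinM muleCA mule_ge0 ?lee_fin//.
      by rewrite -lee_fin EFinM nnfun_muleindic_ge0.
  apply: eq_fsbigr => r; rewrite inE => -[y _ <-].
  rewrite ge0_integralZl//; last 3 first.
    - by apply/measurable_EFinP; exact: measurable_funM.
    - by move=> w _; rewrite lee_fin mulr_ge0.
    - by rewrite lee_fin.
  by rewrite QW// muleCA.
have gcvg y : (0 <= y)%R -> (g n y)%:E @[n --> \oo] --> y%:E.
  move=> y0; apply: (cvg_nnsfun_approx mD mid); last first.
    by rewrite /D/= in_itv/= y0.
  by move=> z; rewrite /D/= in_itv/= andbT lee_fin.
(* Used with [h = Q] and with [h = 1], for the limits of the two sides of [gW]. *)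
have mcv (h : T -> R) : measurable_fun setT h -> (forall w, 0 <= h w)%R ->
    \int[P]_w (h w * g n (W w))%:E @[n --> \oo] --> \int[P]_w (h w * W w)%:E.
  move=> mh h0.
  rewrite [X in _ --> X](_ : _ = \int[P]_w limn (fun n => (h w * g n (W w))%:E)).
    apply: cvg_monotone_convergence => //.
    - by move=> n; apply/measurable_EFinP; exact: measurable_funM.
    - by move=> n w _; rewrite lee_fin mulr_ge0.
    - move=> w _ m n mn; rewrite lee_fin ler_wpM2l//.
      by move/lefP : (nd_nnsfun_approx mD mid mn) => /(_ (W w)).
  apply: eq_integral => w _; apply/esym/cvg_lim => //.
  under eq_fun do rewrite EFinM.
  by rewrite EFinM; apply: cvgeZl => //; exact: gcvg.
have := mcv _ mQ Q0.
under eq_fun do rewrite gW.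
move=> /(cvg_unique _); apply => //.
apply: cvgeZl => //.
have := mcv (cst 1%R) (measurable_cst _) (fun=> ler01).
under eq_fun do under eq_integral do rewrite mul1r.
by under eq_integral do rewrite mul1r.
Qed.

End independence.

(** * Hoeffding's bound for the upper tail *)

Section hoeffding.
Context (dT : measure_display) (T : measurableType dT) (R : realType)
  (P : probability T R) (I : choiceType) (X : I -> {RV P >-> R}) (m : I -> R).
Hypothesis X01 : forall a w, 0 <= X a w <= 1.
Hypothesis EX : forall a, ('E_P[X a] = (m a)%:E)%E.
Hypothesis indX : mutually_independent X.

Let evt (B : I -> set R) (t : seq I) : set T :=
  \big[setI/setT]_(b <- t) (X b @^-1` B b).

Let measurable_evt B t : (forall a, measurable (B a)) -> measurable (evt B t).
Proof.
move=> mB; rewrite /evt; elim/big_ind : _ => //; first exact: measurableI.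
by move=> b _; rewrite -[_ @^-1` _]setTI; exact: measurable_funPT.
Qed.

(** For [c = expR l - 1] each factor dominates [expR (l * X a w)]. Being affine in the reward, it
    has an expectation that depends on the mean only. *)
Let affine_prod (c : R) (s : seq I) (w : T) : R := \prod_(a <- s) (1 + c * X a w).

Let measurable_affine_prod c s : measurable_fun setT (affine_prod c s).
Proof.
apply: measurable_prod => a _; apply: measurable_funD => //.
exact: measurable_funM.
Qed.

Let affine_prod_ge0 (c : R) s w : 0 <= c -> 0 <= affine_prod c s w.
Proof.
move=> c0; apply: prodr_ge0 => a _.
by have /andP[x0 _] := X01 a w; rewrite addr_ge0// mulr_ge0.
Qed.

Lemma mean_ge0 a : 0 <= m a.
Proof.
rewrite -lee_fin -EX expectation_ge0// => w.
by case/andP: (X01 a w).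
Qed.

Lemma mean_le1 a : m a <= 1.
Proof.
rewrite -lee_fin -EX unlock -(@probability_setT _ _ _ P).
rewrite -[P _]mul1e -integral_cst//.
apply: ge0_le_integral => //.
- by move=> w _; rewrite lee_fin; case/andP: (X01 a w).
- exact/measurable_EFinP/measurable_funPT.
- by move=> w _; rewrite lee_fin; case/andP: (X01 a w).
Qed.

(* The indicator makes the induction on [s] go through: the induction hypothesis
   for [a :: t] says that [X a] is independent of the other factors. *)
Lemma integral_affine_prod_indic (c : R) (s t : seq I) (B : I -> set R) :
  0 <= c -> uniq (s ++ t) -> (forall a, measurable (B a)) ->
  (\int[P]_w (affine_prod c s w * \1_(evt B t) w)%:E
   = (\prod_(a <- s) (1 + c * m a))%:E * \prod_(b <- t) P (X b @^-1` B b))%E.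
Proof.
move=> c0; elim: s t B => [|a s IHs] t B st mB.
  rewrite big_nil mul1e.
  under eq_integral do rewrite /affine_prod big_nil mul1r.
  rewrite integral_indic ?setIT//; last exact: measurable_evt.
  by have := indX st mB; rewrite bigcap_seq.
have /andP[ast ust] : (a \notin s ++ t) && uniq (s ++ t) by [].
pose Q w := affine_prod c s w * \1_(evt B t) w.
have mQ : measurable_fun setT Q.
  by apply: measurable_funM => //; exact/measurable_indic/measurable_evt.
have Q0 w : 0 <= Q w by rewrite mulr_ge0// affine_prod_ge0.
have EQ : (\int[P]_w (Q w)%:E =
  (\prod_(a <- s) (1 + c * m a))%:E * \prod_(b <- t) P (X b @^-1` B b))%E.
  exact: IHs.
have mXB b (A : set R) : measurable A -> measurable (X b @^-1` A).
  by move=> mA; rewrite -[_ @^-1` _]setTI; exact: measurable_funPT.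
have Qfin : (\int[P]_w (Q w)%:E \is a fin_num)%E.
  rewrite EQ fin_numM// prode_fin_num// => b _.
  by rewrite fin_num_measure//; exact: mXB.
have QX : (\int[P]_w (Q w * X a w)%:E =
    (\int[P]_w (Q w)%:E) * \int[P]_w (X a w)%:E)%E.
  apply: integral_mul_indep => //.
  - by move=> w; case/andP: (X01 a w).
  move=> A mA.
  (* With [A] as the event of index [a], the induction hypothesis for [a :: t] computes the integral
     of [Q] times the indicator of [X a] in [A]. *)
  pose B' b := if b == a then A else B b.
  have B'B b : b \in t -> B' b = B b.
    rewrite /B'; case: eqP => // -> bt; move: ast.
    by rewrite mem_cat bt orbT.
  have B'a : B' a = A by rewrite /B' eqxx.
  have u' : uniq (s ++ a :: t) by rewrite -cat1s uniq_catCA.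
  have mB' b : measurable (B' b) by rewrite /B'; case: ifP.
  have := IHs _ B' u' mB'.
  rewrite big_cons B'a (eq_big_seq (fun b => P (X b @^-1` B b))); last first.
    by move=> b bt; rewrite B'B.
  rewrite muleCA -EQ muleC => <-.
  apply: eq_integral => w _; rewrite /Q -mulrA; congr (_ * _)%:E.
  rewrite /evt big_cons B'a indicI /= mulrC; congr (_ * _).
  by congr (\1_ _ w); apply: eq_big_seq => b bt; rewrite B'B.
(* The factor [1 + c * X a w] is expanded; [QX] takes care of the second term. *)
transitivity (\int[P]_w ((Q w)%:E + (c * (Q w * X a w))%:E))%E.
  apply: eq_integral => w _; rewrite -EFinD /affine_prod big_cons.
  by rewrite -/(affine_prod c s w); congr EFin; rewrite /Q; ring.
have QX0 w : 0 <= Q w * X a w by rewrite mulr_ge0//; case/andP: (X01 a w).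
have mQX : measurable_fun setT (fun w => Q w * X a w) by exact: measurable_funM.
rewrite ge0_integralD//; last 4 first.
- by move=> w _; rewrite lee_fin.
- exact/measurable_EFinP.
- by move=> w _; rewrite lee_fin mulr_ge0.
- by apply/measurable_EFinP; exact: measurable_funM.
under [X in (_ + X)%E]eq_integral do rewrite EFinM.
rewrite ge0_integralZl//; last 2 first.
- exact/measurable_EFinP.
- by move=> w _; rewrite lee_fin.
rewrite QX -expectation_def EX big_cons EFinM -muleA -EQ EFinD EFinM.
rewrite [in RHS]ge0_muleDl ?lee_fin ?mulr_ge0 ?mean_ge0//.
by rewrite mul1e -muleA [X in (_ * X)%E]muleC.
Qed.

(** Convexity of the exponential between the points 0 and [l]. *)
Lemma expR_chord (l x : R) : 0 <= x <= 1 -> expR (l * x) <= 1 + (expR l - 1) * x.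
Proof.
move=> /andP[x0 x1]; have := @convex_expR _ (Itv01 x0 x1) l 0.
rewrite !convRE/= /unstable.onem expR0 mulr0 addr0 mulr1 mulrC => /le_trans; apply.
by lra.
Qed.

(** Chernoff's method: the indicator of the tail event is dominated by a multiple of [affine_prod],
    whose expectation factors and is then bounded by [bernoulli_mgf_le]. *)
Lemma hoeffding_upper (s : seq I) (p eps : R) :
  uniq s -> (forall a, a \in s -> m a = p) -> 0 <= eps ->
  (P [set w | ((size s)%:R * (p + eps) <= \sum_(a <- s) X a w)%R]
   <= (expR (- (2 * (size s)%:R * eps ^+ 2)))%:E)%E.
Proof.
move=> us mp e0; set M := (size s)%:R; set A := [set w | _].
have mS : measurable_fun setT (fun w => \sum_(a <- s) X a w).
  by apply: measurable_sum => a; exact: measurable_funPT.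
have mA : measurable A.
  rewrite -[A]setTI; exact: measurable_fun_le (measurable_cst _) mS.
(* The empty family is treated apart, since [0 <= p <= 1] is deduced from a member of [s]. *)
have [s0|s0] := eqVneq (size s) 0%N.
  by rewrite /M s0 mulr0 mul0r oppr0 expR0 probability_le1.
have /andP[p0 p1] : 0 <= p <= 1.
  case: (s) mp s0 => // a s' mp _.
  by rewrite -(mp a) ?mem_head// mean_ge0 mean_le1.
(* This [l] minimises [l ^+ 2 / 8 - l * eps]; the minimum [- 2 * eps ^+ 2] is the exponent gained
   per sample. *)
pose l : R := 4 * eps; pose c : R := expR l - 1.
have l0 : 0 <= l by rewrite mulr_ge0.
have c0 : 0 <= c by rewrite subr_ge0 -expR0 ler_expR.
pose K := expR (- (l * (M * (p + eps)))).
have step w : \1_A w <= K * affine_prod c s w.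
  rewrite indicE; have [|_] := boolP (w \in A); last first.
    by rewrite mulr_ge0 ?expR_ge0// affine_prod_ge0.
  rewrite inE /A/= => Mw.
  apply: (@le_trans _ _ (K * expR (l * \sum_(a <- s) X a w))).
    rewrite -expRD -expR0 ler_expR addrC subr_ge0.
    exact: ler_wpM2l.
  rewrite ler_wpM2l ?expR_ge0// mulr_sumr expR_sum.
  apply: ler_prod => a _; rewrite expR_ge0/=; exact: expR_chord.
have -> : P A = (\int[P]_w (\1_A w)%:E)%E by rewrite integral_indic ?setIT.
apply: (@le_trans _ _ (\int[P]_w (K%:E * (affine_prod c s w)%:E))%E).
  apply: ge0_le_integral => //.
  - exact/measurable_EFinP/measurable_indic.
  - apply: emeasurable_funM => //; exact/measurable_EFinP.
  - by move=> w _; rewrite -EFinM lee_fin.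
have K0 : 0 <= K by exact: expR_ge0.
rewrite ge0_integralZl//; last 2 first.
- exact/measurable_EFinP.
- by move=> w _; rewrite lee_fin affine_prod_ge0.
have -> : (\int[P]_w (affine_prod c s w)%:E = (\prod_(a <- s) (1 + c * m a))%:E)%E.
  have := @integral_affine_prod_indic c s [::] (fun=> setT) c0.
  rewrite cats0 big_nil mule1 /evt big_nil => /(_ us (fun=> measurableT)) <-.
  by apply: eq_integral => w _; rewrite indicT mulr1.
rewrite -EFinM lee_fin.
rewrite (eq_big_seq (fun=> 1 + c * p)); last by move=> a /mp ->.
rewrite big_const_seq count_predT iter_mulr_1.
have p01 : 0 <= p <= 1 by rewrite p0.
apply: (@le_trans _ _ (K * expR (l * p + l ^+ 2 / 8) ^+ size s)).
  rewrite ler_wpM2l ?expR_ge0// lerXn2r ?nnegrE ?expR_ge0//.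
    by rewrite addr_ge0// mulr_ge0.
  exact: bernoulli_mgf_le.
rewrite -expRM_natl -expRD ler_expR /l -/M.
by lra.
Qed.

End hoeffding.

(** * Hoeffding's bound for both tails *)

Section hoeffding_two_sided.
Context (dT : measure_display) (T : measurableType dT) (R : realType)
  (P : probability T R) (I : choiceType) (X : I -> {RV P >-> R}) (m : I -> R).
Hypothesis X01 : forall a w, 0 <= X a w <= 1.
Hypothesis EX : forall a, ('E_P[X a] = (m a)%:E)%E.
Hypothesis indX : mutually_independent X.

(** The lower tail of [X] is the upper tail of these reflected variables, which satisfy the same
    hypotheses with means [1 - m a]. *)
Let Y (a : I) : {RV P >-> R} := (cst 1 \- X a).

Let Y01 a w : 0 <= Y a w <= 1.
Proof. by case/andP: (X01 a w) => X0 X1; rewrite /= subr_ge0 X1 gerBl. Qed.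

Let EY a : ('E_P[Y a] = (1 - m a)%:E)%E.
Proof.
have : ('E_P[Y a] + 'E_P[X a] = 1)%E.
  rewrite !expectation_def -ge0_integralD//.
  - under eq_integral do rewrite -EFinD /= subrK.
    by rewrite (integral_cst P measurableT 1) mul1e; exact: probability_setT.
  - by move=> w _; rewrite lee_fin; case/andP: (Y01 a w).
  - exact/measurable_EFinP/measurable_funPT.
  - by move=> w _; rewrite lee_fin; case/andP: (X01 a w).
  - exact/measurable_EFinP/measurable_funPT.
rewrite EX => E1; rewrite EFinB -E1 addeK//.
Qed.

Let indY : mutually_independent Y.
Proof.
move=> s B us mB; pose B' a := (fun y : R => 1 - y) @^-1` B a.
have := @indX s B' us; apply => a.
rewrite -[B' a]setTI.
have : measurable_fun [set: R] (fun y : R => 1 - y) by exact: measurable_funB.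
by apply.
Qed.

Lemma hoeffding_two_sided (s : seq I) (p eps : R) :
  uniq s -> (forall a, a \in s -> m a = p) -> 0 <= eps ->
  (P [set w | ((size s)%:R * eps <= `|\sum_(a <- s) X a w - (size s)%:R * p|)%R]
   <= (2 * expR (- (2 * (size s)%:R * eps ^+ 2)))%:E)%E.
Proof.
move=> us mp e0; set M := (size s)%:R.
have mS (Z : I -> {RV P >-> R}) :
    measurable_fun setT (fun w => \sum_(a <- s) Z a w).
  by apply: measurable_sum => a; exact: measurable_funPT.
pose U (Z : I -> {RV P >-> R}) (q : R) :=
  [set w | (M * (q + eps) <= \sum_(a <- s) Z a w)%R].
have mU Z q : measurable (U Z q).
  rewrite -[U Z q]setTI; exact: measurable_fun_le (measurable_cst _) (mS Z).
have UX := hoeffding_upper X01 EX indX us mp e0.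
have mp' a : a \in s -> 1 - m a = 1 - p by move/mp => ->.
have UY := hoeffding_upper Y01 EY indY us mp' e0.
have sub : [set w | M * eps <= `|\sum_(a <- s) X a w - M * p|] `<=`
    U X p `|` U Y (1 - p).
  move=> w /=; rewrite /U/= sumrB big_const_seq count_predT iter_addr_0 -/M.
  rewrite ler_normr => /orP[h|h]; [left|right]; lra.
apply: (@le_trans _ _ (P (U X p `|` U Y (1 - p)))).
  apply: le_measure; rewrite ?inE//; last exact: measurableU.
  rewrite -[X in measurable X]setTI.
  have mN : measurable_fun setT (fun w => `|\sum_(a <- s) X a w - M * p|).
    apply: (measurableT_comp (@normr_measurable R setT)).
    exact: measurable_funB.
  exact: measurable_fun_le (measurable_cst _) mN.
have := measureU2 P (mU X p) (mU Y (1 - p)) => /le_trans; apply.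
by rewrite mulr_natl mulr2n EFinD leeD.
Qed.

End hoeffding_two_sided.

(** * Sample budgets *)

Section budget.
Variables (R : realType) (k n : nat) (delta : R) (e : nat -> R).
Hypotheses (k_gt0 : (0 < k)%N) (n_gt0 : (0 < n)%N) (delta01 : 0 < delta < 1).
Hypotheses (e_gt0 : forall r, 0 < e r) (e_noninc : forall r, e r.+1 <= e r).

Definition log_factor (r : nat) : R := ln (4 * n%:R * r%:R ^+ 2 / delta).

Let arg_gt1 (r : nat) : (0 < r)%N -> 1 < 4 * n%:R * r%:R ^+ 2 / delta.
Proof.
case/andP: delta01 => d0 d1 r0.
have n1 : (1 : R) <= n%:R by rewrite ler1n.
have r1 : (1 : R) <= r%:R ^+ 2 by rewrite exprn_ege1// ler1n.
rewrite ltr_pdivlMr// mul1r (lt_le_trans d1)// mulr_ege1//; lra.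
Qed.

Lemma log_factor_ge0 r : (0 < r)%N -> 0 <= log_factor r.
Proof. by move=> r0; rewrite ln_ge0// ltW// arg_gt1. Qed.

Lemma log_factor_le q r : (0 < q <= r)%N -> log_factor q <= log_factor r.
Proof.
case/andP => q0 qr; have r0 : (0 < r)%N by exact: leq_trans qr.
case/andP: delta01 => d0 d1.
rewrite /log_factor ler_ln ?posrE ?(lt_trans ltr01) ?arg_gt1//.
by rewrite ler_pM2r ?invr_gt0// ler_wpM2l ?mulr_ge0// lerXn2r ?nnegrE// ler_nat.
Qed.

Lemma budgetE r : (0 < r)%N ->
  budget k n delta e r = 2 / (k%:R * e r ^+ 2) * log_factor r.
Proof. by case: r. Qed.

Lemma budget_ge0 r : 0 <= budget k n delta e r.
Proof.
case: r => [|r]; first by rewrite /budget eqxx.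
rewrite budgetE// mulr_ge0 ?log_factor_ge0//.
by rewrite divr_ge0// mulr_ge0// exprn_ge0// ltW.
Qed.

Lemma budget_le r : budget k n delta e r <= budget k n delta e r.+1.
Proof.
case: r => [|r]; first by rewrite [leLHS]/budget eqxx budget_ge0.
rewrite !budgetE// ler_pM ?log_factor_ge0//.
- by rewrite divr_ge0// mulr_ge0// exprn_ge0// ltW.
- have k0 : 0 < k%:R :> R by rewrite ltr0n.
  rewrite ler_wpM2l// lef_pV2 ?posrE ?mulr_gt0 ?exprn_gt0//.
  by rewrite ler_wpM2l// lerXn2r ?nnegrE ?e_noninc// ltW.
- by rewrite log_factor_le/=.
Qed.

Lemma nsamplesE r :
  (nsamples k n delta e r)%:R = (Num.ceil (budget k n delta e r))%:~R :> R.
Proof.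
rewrite /nsamples natr_absz ger0_norm// ceil_ge0.
by rewrite (lt_le_trans _ (budget_ge0 r))// ltrN10.
Qed.

Lemma budget_le_nsamples r : budget k n delta e r <= (nsamples k n delta e r)%:R.
Proof. by rewrite nsamplesE ceil_ge. Qed.

Lemma nsamples_le_budget r : (nsamples k n delta e r)%:R <= budget k n delta e r + 1.
Proof.
rewrite nsamplesE; have /andP[+ _] := ceil_itv (budget k n delta e r).
by rewrite intrB; lra.
Qed.

Lemma nsamples0 : nsamples k n delta e 0 = 0%N.
Proof. by rewrite /nsamples/budget eqxx ceil0. Qed.

(** Makes the truncated subtraction in [pulls_per_player] exact, so that the pulls of an arm
    telescope. *)
Lemma nsamples_le r : (nsamples k n delta e r <= nsamples k n delta e r.+1)%N.
Proof. by rewrite -(ler_nat R) !nsamplesE ler_int le_ceil// budget_le. Qed.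

(** Ensures that the averages of a round never divide by zero. *)
Lemma nsamples_gt0 r : (0 < r)%N -> (0 < nsamples k n delta e r)%N.
Proof.
move=> r0; rewrite -(ltr_nat R) (lt_le_trans _ (budget_le_nsamples r))//.
rewrite budgetE// mulr_gt0//.
  by rewrite divr_gt0// mulr_gt0 ?ltr0n// exprn_gt0.
by rewrite ln_gt0// arg_gt1.
Qed.

End budget.

(** The logarithm splits into [ln 4], which is at most 2, [ln n], twice [ln r] and [ln delta^-1].
    The factor 32 is the 16 of [pulls_le], doubled to absorb rounding up. *)
Lemma log_factor_bound (R : realType) (k n r : nat) (eps delta rounds : R) :
  (0 < n)%N -> (0 < k)%N -> (0 < r)%N -> 0 < eps < 1 -> 0 < delta < 1 ->
  r%:R <= rounds ->
  32 * log_factor n delta r <= (1 + ln rounds) * polylog 64 1 k n eps delta.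
Proof.
move=> n0 k0 r0 /andP[e0 e1] /andP[d0 d1] rr.
have r1 : (1 : R) <= r%:R by rewrite ler1n.
have lr : ln r%:R <= ln rounds by rewrite ler_ln ?posrE//; lra.
have lr0 : 0 <= ln (r%:R : R) by exact: ln_ge0.
have ln0 : 0 <= ln (n%:R : R) by rewrite ln_ge0// ler1n.
have lk0 : 0 <= ln (k%:R : R) by rewrite ln_ge0// ler1n.
have le0 : 0 <= ln eps^-1 by rewrite ln_ge0// invf_ge1// ltW.
have ld0 : 0 <= ln delta^-1 by rewrite ln_ge0// invf_ge1// ltW.
have l4 : ln 4 <= (2 : R).
  have -> : (4 : R) = (1 + 1) ^+ 2 by ring.
  by rewrite lnXn ?addr_gt0// mulr2n -[X in _ <= X]/(1 + 1) lerD// le_ln1Dx.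
rewrite /log_factor /polylog expr1.
have -> : ln (4 * n%:R * r%:R ^+ 2 / delta) =
    ln 4 + ln n%:R + ln r%:R *+ 2 + ln delta^-1.
  rewrite lnM ?posrE ?invr_gt0// ?mulr_gt0 ?exprn_gt0 ?ltr0n//; congr (_ + _).
  rewrite lnM ?posrE ?mulr_gt0 ?exprn_gt0 ?ltr0n// lnXn ?ltr0n//; congr (_ + _).
  by rewrite lnM ?posrE ?ltr0n.
set a := ln n%:R in ln0 *; set b := ln delta^-1 in ld0 *.
set c := ln k%:R in lk0 *; set d := ln eps^-1 in le0 *.
set u := ln rounds in lr *.
have : 0 <= u * (a + c + d + b) by rewrite mulr_ge0; lra.
lra.
Qed.

(** * Deterministic analysis of an accurate run *)

(* [rho] is the ratio eps^(-1/N) of the schedule. *)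
Section good_run.
Variables (R : realType) (k n : nat) (delta eps theta rho : R) (e : nat -> R).
Variables (p : 'I_n -> R) (a1 : 'I_n) (x : 'I_k -> 'I_n -> nat -> R) (M : nat).
Hypotheses (k_gt0 : (0 < k)%N) (n_gt1 : (1 < n)%N).
Hypotheses (delta01 : 0 < delta < 1) (eps01 : 0 < eps < 1).
Hypotheses (e_gt0 : forall r, 0 < e r) (e0 : e 0%N = 1).
Hypotheses (rho_ge1 : 1 <= rho) (eS : forall r, e r = e r.+1 * rho).
Hypotheses (p01 : forall i, 0 <= p i <= 1) (p_a1 : forall i, p i <= p a1).
Hypothesis x_ge0 : forall j i s, 0 <= x j i s.
Hypothesis accurate : forall r i, (0 < r <= M)%N ->
  `|pooled_mean delta e x r i - p i| <= e r / 2.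
Hypotheses (theta_ge : eps / 2 <= theta) (M_gt0 : (0 < M)%N) (eM : e M <= theta).

Let S := survivors delta e x.
Let ns := nsamples k n delta e.

Lemma pooled_mean_ge0 r i : 0 <= pooled_mean delta e x r i.
Proof.
rewrite divr_ge0//; apply: sumr_ge0 => j _; rewrite divr_ge0//.
by apply: sumr_ge0.
Qed.

Lemma survivorsS r i : (i \in S r.+1) = (i \in S r) &&
  (best_mean delta e x r.+1 (S r) - e r.+1 <= pooled_mean delta e x r.+1 i).
Proof.
rewrite /S/= finset.in_setD finset.in_set negb_and -leNgt andbC.
by case: (i \in _).
Qed.

Lemma survivors_sub q r i : (q <= r)%N -> i \in S r -> i \in S q.
Proof.
elim: r => [|r IH]; first by rewrite leqn0 => /eqP->.
rewrite leq_eqVlt => /predU1P[->//|]; rewrite ltnS => /IH qr.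
by rewrite survivorsS => /andP[/qr].
Qed.

(** Two errors of at most [e r / 2] cannot put another arm more than [e r] ahead of the best one. *)
Lemma best_survives r : (r <= M)%N -> a1 \in S r.
Proof.
elim: r => [|r IH] rM; first by rewrite /S/= finset.in_setT.
rewrite survivorsS IH ?(ltnW rM)//= lerBlDr.
have acc i : `|pooled_mean delta e x r.+1 i - p i| <= e r.+1 / 2.
  exact: accurate.
apply/bigmax_leP; split => [|i _].
  (* This is the default value 0 of the maximum. *)
  by rewrite addr_ge0// ?pooled_mean_ge0// ltW.
have := acc i; have := acc a1; rewrite !ler_norml => /andP[h1 _] /andP[_ h2].
have := p_a1 i; lra.
Qed.

(** The best arm still competes in round [r], so a survivor trails it by at most [e r] in pooled
    mean; the two estimation errors add another [e r]. *)
Lemma survivor_gap r i : (0 < r <= M)%N -> i \in S r ->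
  gap p a1 i <= 2 * e r.
Proof.
case: r => // r rM; rewrite survivorsS => /andP[iS le_i].
have a1S : a1 \in S r by rewrite best_survives// ltnW.
have best : pooled_mean delta e x r.+1 a1 <= best_mean delta e x r.+1 (S r).
  exact: (le_bigmax_cond _ (pooled_mean delta e x r.+1)).
have := accurate i rM; have := accurate a1 rM.
rewrite !ler_norml /gap => /andP[h1 _] /andP[_ h2]; lra.
Qed.

Lemma stops_within : exists2 r, stops_after delta e theta x r & (r <= M)%N.
Proof.
pose Q r := (0 < r)%N && stop_test delta e theta x r.
have QM : Q M by rewrite /Q M_gt0 /stop_test eM.
have exQ : exists r, Q r by exists M.
exists (ex_minn exQ); case: ex_minnP => r /andP[r0 st] minr; last exact: minr.
split=> // q /andP[q0 qr]; apply/negP => stq.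
by have := minr q; rewrite /Q q0 stq => /(_ isT); rewrite leqNgt qr.
Qed.

Section stopped.
Variable r : nat.
Hypotheses (r_stop : stops_after delta e theta x r) (rM : (r <= M)%N).

Let r_gt0 : (0 < r)%N. Proof. by case: r_stop. Qed.

Let survivors_neq0 : S r != finset.set0.
Proof. by apply/set0Pn; exists a1; rewrite best_survives. Qed.

Let stop_cases : e r <= theta \/ S r = [set a1]%SET.
Proof.
case: r_stop => _ /orP[st|/cards1P[b Sb]] _; [by left|right].
by have := best_survives rM; rewrite /S Sb finset.in_set1 => /eqP ->.
Qed.

(** The arm with the largest pooled mean does not trail the best arm at all, so only the two errors
    remain: its gap is at most [e r] instead of [2 * e r], and stopping at [eps] suffices. *)
Lemma top_survivor_eps_best ret : returns_top_survivor ret -> theta = eps ->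
  eps_best p a1 eps (ret (S r) (pooled_mean delta e x r)).
Proof.
move=> hret thE; have [rS top] := hret _ (pooled_mean delta e x r) survivors_neq0.
have /andP[eps0 _] := eps01.
have [er|Sr] := stop_cases; last first.
  by move: rS; rewrite Sr finset.in_set1 /eps_best => /eqP ->; rewrite gerBl ltW.
set i := ret _ _ in rS top *; have := top a1 (best_survives rM).
have rr : (0 < r <= M)%N by rewrite r_gt0.
have := accurate i rr; have := accurate a1 rr.
rewrite !ler_norml /eps_best => /andP[h1 _] /andP[_ h2]; lra.
Qed.

Lemma survivor_eps_best ret : returns_survivor ret -> theta = eps / 2 ->
  eps_best p a1 eps (ret (S r) (pooled_mean delta e x r)).
Proof.
move=> hret thE; have rS := hret _ (pooled_mean delta e x r) survivors_neq0.
have /andP[eps0 _] := eps01.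
have [er|Sr] := stop_cases; last first.
  by move: rS; rewrite Sr finset.in_set1 /eps_best => /eqP ->; rewrite gerBl ltW.
have := survivor_gap _ rS; rewrite r_gt0 => /(_ rM).
rewrite /gap /eps_best; lra.
Qed.

(** The gap is bounded by [survivor_gap], or by 1 when [q = 0]. The bound on [eps] holds because the
    loop went on after round [q], so that [e q] exceeds [theta], itself at least [eps / 2]. *)
Lemma eps_gap_survivor q i : (q < r)%N -> i \in S q ->
  eps_gap p a1 eps i <= 2 * e q.
Proof.
have /andP[eps0 eps1] := eps01.
have /andP[pi0 _] := p01 i; have /andP[_ pa1] := p01 a1.
case: q => [|q] qr iS; rewrite /eps_gap ge_max.
  by rewrite e0 /gap; apply/andP; split; lra.
have qM : (0 < q.+1 <= M)%N by rewrite /= (leq_trans (ltnW qr)).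
rewrite (survivor_gap qM iS)/=.
case: r_stop => _ _ /(_ q.+1); rewrite ltn0Sn qr => /(_ isT).
rewrite negb_or -ltNge => /andP[h _]; rewrite mulrC -ler_pdivrMr//.
exact: le_trans theta_ge (ltW h).
Qed.


(** * Counting the pulls of a stopped run *)

Let n_gt0 : (0 < n)%N. Proof. exact: ltnW. Qed.

Let e_noninc q : e q.+1 <= e q.
Proof. by rewrite [leRHS]eS ler_peMr// ltW. Qed.

Let arm_pulls (m : nat) (i : 'I_n) : nat :=
  (\sum_(1 <= q < m.+1 | i \in S q.-1) (ns q - ns q.-1))%N.

Let pulls_arm_pulls m :
  pulls_per_player delta e x m = (\sum_(i < n) arm_pulls m i)%N.
Proof.
rewrite /arm_pulls /pulls_per_player.
under eq_bigr do rewrite big_mkcond/=.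
by rewrite exchange_big/=; apply: eq_bigr => i _; rewrite [in RHS]big_mkcond.
Qed.

Let arm_pullsS m i : arm_pulls m.+1 i =
  (arm_pulls m i + if i \in S m then ns m.+1 - ns m else 0)%N.
Proof. by rewrite /arm_pulls big_mkcond big_nat_recr//= -big_mkcond. Qed.

Let arm_pulls_le m i : (arm_pulls m i <= ns m)%N.
Proof.
elim: m => [|m IH]; first by rewrite /arm_pulls big_geq.
have le_ns : (ns m <= ns m.+1)%N by exact: nsamples_le.
rewrite arm_pullsS; case: ifP => _; last by rewrite addn0 (leq_trans IH).
by rewrite -[leqRHS](subnKC le_ns) leq_add2r.
Qed.

(** By telescoping, the total is at most the sample number of the last round in which the arm takes
    part. *)
Let arm_pulls_last m i (b : R) : 0 <= b ->
  (forall q, (q < m)%N -> i \in S q -> (ns q.+1)%:R <= b) ->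
  (arm_pulls m i)%:R <= b.
Proof.
move=> b0; elim: m => [|m IH] mb; first by rewrite /arm_pulls big_geq.
have [iS|iS] := boolP (i \in S m).
  by rewrite (le_trans _ (mb m _ iS))// ler_nat arm_pulls_le.
rewrite arm_pullsS (negbTE iS) addn0 IH// => q qm; apply: mb.
exact: leq_trans qm _.
Qed.

(** The 8 is the 2 of the budget times the square of the 2 in [eps_gap_survivor]. *)
Let arm_cost (i : 'I_n) : R :=
  8 * log_factor n delta r * (rho ^+ 2 / k%:R * (eps_gap p a1 eps i) ^- 2).

Let eps_gap_gt0 i : 0 < eps_gap p a1 eps i.
Proof. by case/andP: eps01 => eps0 _; rewrite lt_max eps0 orbT. Qed.

Let arm_cost_ge0 i : 0 <= arm_cost i.
Proof.
have rho0 : 0 <= rho := le_trans ler01 rho_ge1.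
rewrite !mulr_ge0 ?invr_ge0 ?exprn_ge0 ?(ltW (eps_gap_gt0 i))//.
exact: log_factor_ge0.
Qed.

(* 1 / e_{q+1}^2 = rho^2 / e_q^2, and [i] has gap at most 2 e_q. *)
Let budget_arm_cost q i : (q < r)%N -> i \in S q ->
  budget k n delta e q.+1 <= arm_cost i.
Proof.
move=> qr iS; rewrite budgetE//.
have k0 : 0 < k%:R :> R by rewrite ltr0n.
have rho0 : 0 < rho := lt_le_trans ltr01 rho_ge1.
have L0 : 0 <= log_factor n delta q.+1 :> R by exact: log_factor_ge0.
have LL : log_factor n delta q.+1 <= log_factor n delta r :> R.
  exact: log_factor_le.
have gq := eps_gap_survivor qr iS.
have g0 := eps_gap_gt0 i.
have -> : arm_cost i =
    2 / (k%:R * (eps_gap p a1 eps i / 2 / rho) ^+ 2) * log_factor n delta r.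
  by rewrite /arm_cost; field; rewrite !gt_eqF.
rewrite ler_pM//.
  by rewrite divr_ge0// mulr_ge0// exprn_ge0// ltW.
have gr0 : 0 < eps_gap p a1 eps i / 2 / rho by rewrite !divr_gt0.
rewrite ler_wpM2l// lef_pV2 ?posrE ?(mulr_gt0 k0) ?exprn_gt0//.
rewrite ler_wpM2l// lerXn2r ?nnegrE ?(ltW gr0) ?(ltW (e_gt0 _))//.
rewrite ler_pdivrMr// -eS ler_pdivrMr// mulrC.
exact: gq.
Qed.

(* The best arm is pulled as often as some other arm, since it competes with
   another survivor in the last round. *)
Let best_rival : exists2 i, i != a1 & i \in S r.-1.
Proof.
have a1S : a1 \in S r.-1 by rewrite best_survives// (leq_trans (leq_pred _)).
(* For [r = 1] all [n > 1] arms are present; for larger [r] the stopping test failed after round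
   [r.-1]. *)
have cS : (1 < #|S r.-1|)%N.
  have : #|S r.-1| != 1%N.
    case: r_stop; case: (r) => [//|[|q]] _ _ qst.
      by rewrite /S/= cardsT card_ord; case: n n_gt1 => [|[]].
    by have := qst q.+1; rewrite /= ltnS leqnn negb_or => /(_ isT)/andP[].
  have : (0 < #|S r.-1|)%N by rewrite card_gt0; apply/set0Pn; exists a1.
  by case: #|_| => [|[]].
have : (0 < #|S r.-1 :\ a1|)%N by move: cS; rewrite (cardsD1 a1) a1S.
by rewrite card_gt0 => /set0Pn[i]; rewrite !inE => /andP[? ?]; exists i.
Qed.

(** The constants [c0] and [c1] describe the effect of rounding up the budgets. The 16 is twice the
    8 of [arm_cost]: the best arm costs at most the sum over all other arms once more. *)
Lemma pulls_le (c0 c1 : R) : 0 <= c0 -> 0 <= c1 ->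
  (forall q, (0 < q)%N -> (ns q)%:R <= c1 * budget k n delta e q + c0) ->
  (pulls_per_player delta e x r)%:R <=
    c1 * (16 * log_factor n delta r) *
      (rho ^+ 2 / k%:R * \sum_(i < n | i != a1) (eps_gap p a1 eps i) ^- 2)
    + c0 * n%:R.
Proof.
move=> c00 c10 nsb; rewrite pulls_arm_pulls natr_sum (bigD1 a1)//=.
have other i : (arm_pulls r i)%:R <= c1 * arm_cost i + c0.
  apply: arm_pulls_last => [|q qr iS]; first by rewrite addr_ge0// mulr_ge0.
  by rewrite (le_trans (nsb _ _))// lerD2r ler_wpM2l// budget_arm_cost.
have best : (arm_pulls r a1)%:R <= c1 * \sum_(i < n | i != a1) arm_cost i + c0.
  have [i ia iS] := best_rival.
  apply: (@le_trans _ _ (c1 * arm_cost i + c0)).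
    apply: (@le_trans _ _ (ns r)%:R); first by rewrite ler_nat arm_pulls_le.
    rewrite (le_trans (nsb _ _))// lerD2r ler_wpM2l//.
    by rewrite -(prednK r_gt0) budget_arm_cost// prednK.
  by rewrite lerD2r ler_wpM2l// (bigD1 i)//= lerDl sumr_ge0.
apply: (le_trans (lerD best (ler_sum _ (fun i _ => other i)))).
rewrite big_split/= -mulr_sumr sumr_const (_ : #|_| = n.-1); last first.
  by rewrite -[in RHS](card_ord n) -(cardC1 a1).
(* Each arm contributes one rounding term [c0]: the best arm one, the others [n.-1]. *)
have -> : n%:R = 1 + n.-1%:R :> R by rewrite nat1r prednK.
rewrite /arm_cost -!mulr_sumr -mulr_natr le_eqVlt; apply/orP; left; apply/eqP.
by ring.
Qed.

End stopped.
End good_run.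

(** * Probability of an accurate run *)

Lemma probability_bigsetU_le (dT : measure_display) (T : measurableType dT)
    (R : realType) (P : probability T R) (I : Type) (s : seq I) (F : I -> set T) :
  (forall i, measurable (F i)) ->
  (P (\big[setU/set0]_(i <- s) F i) <= \sum_(i <- s) P (F i))%E.
Proof.
move=> mF; elim: s => [|i s IH]; first by rewrite !big_nil measure0.
rewrite !big_cons; have mU : measurable (\big[setU/set0]_(j <- s) F j).
  exact: bigsetU_measurable.
have := measureU2 P (mF i) mU => /le_trans; apply.
by rewrite leeD2l.
Qed.

(** Comparison with a telescoping series: the first [m] terms sum to at most [2 - m^-1]. *)
Lemma sum_inv_sqr_le2 (R : realFieldType) (m : nat) :
  \sum_(r < m) (r.+1%:R ^- 2 : R) <= 2.
Proof.
case: m => [|m]; first by rewrite big_ord0.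
suff : \sum_(r < m.+1) (r.+1%:R ^- 2 : R) <= 2 - m.+1%:R^-1.
  by move/le_trans; apply; rewrite gerBl invr_ge0.
elim: m => [|m IH]; first by rewrite big_ord1 expr1n invr1 lerBrDr.
rewrite big_ord_recr/= (le_trans (lerD IH (lexx _)))//.
have m1 : 0 < m.+1%:R :> R by rewrite ltr0n.
have -> : m.+2%:R = m.+1%:R + 1 :> R by rewrite natr1.
move: (m.+1%:R : R) m1 => a a0.
rewrite -subr_ge0 (_ : _ - _ = (a * (a + 1) ^+ 2)^-1); last first.
  by field; rewrite !gt_eqF// addr_gt0.
by rewrite invr_ge0 mulr_ge0 ?exprn_ge0 ?addr_ge0// ltW.
Qed.

Section accuracy.
Context (dT : measure_display) (T : measurableType dT) (R : realType)
  (P : probability T R).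
Variables (k n : nat) (p : 'I_n -> R) (X : 'I_k * 'I_n * nat -> {RV P >-> R}).
Variables (delta : R) (e : nat -> R).
Hypothesis model : reward_model p X.
Hypotheses (k_gt0 : (0 < k)%N) (n_gt0 : (0 < n)%N) (delta01 : 0 < delta < 1).
Hypotheses (e_gt0 : forall r, 0 < e r) (e_noninc : forall r, e r.+1 <= e r).

Let x (w : T) (j : 'I_k) (i : 'I_n) (s : nat) : R := X (j, i, s) w.

(** All players have sampled the arm equally often, so the mean of their means is the plain average
    over these independent rewards. *)
Let samples r (i : 'I_n) : seq ('I_k * 'I_n * nat) :=
  [seq (j, i, s) | j <- enum 'I_k, s <- iota 0 (nsamples k n delta e r)].

Let size_samples r i : size (samples r i) = (k * nsamples k n delta e r)%N.
Proof. by rewrite size_allpairs size_enum_ord size_iota. Qed.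

Let sum_samples r i w : (0 < r)%N -> \sum_(a <- samples r i) X a w =
  (size (samples r i))%:R * pooled_mean delta e (x w) r i.
Proof.
move=> r0; rewrite size_samples natrM /pooled_mean /player_mean -mulr_suml.
have k0 : k%:R != 0 :> R by rewrite pnatr_eq0 -lt0n.
have N0 : (nsamples k n delta e r)%:R != 0 :> R.
  by rewrite pnatr_eq0 -lt0n nsamples_gt0.
transitivity (\sum_(j < k) \sum_(s < nsamples k n delta e r) x w j i s); last first.
  by field; rewrite N0 k0.
rewrite big_allpairs_dep big_enum/=; apply: eq_bigr => j _.
by rewrite -(big_mkord xpredT (x w j i)) /index_iota subn0.
Qed.

Definition inaccurate r i : set T :=
  [set w | e r / 2 <= `|pooled_mean delta e (x w) r i - p i|].

Lemma inaccurate_le r i : (0 < r)%N -> measurable (inaccurate r i) /\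
  (P (inaccurate r i) <= (delta / (2 * n%:R) * r%:R ^- 2)%:E)%E.
Proof.
move=> r0.
set N := (size (samples r i))%:R : R.
have N0 : 0 < N.
  by rewrite /N size_samples ltr0n muln_gt0 k_gt0 nsamples_gt0.
have e0 : 0 <= e r / 2 by rewrite divr_ge0// ltW.
have -> : inaccurate r i =
    [set w | N * (e r / 2) <= `|\sum_(a <- samples r i) X a w - N * p i|].
  apply/seteqP; split => w; rewrite /inaccurate/= sum_samples// -/N -mulrBr normrM;
  by rewrite (gtr0_norm N0) ler_pM2l.
split.
  have mN : measurable_fun setT
      (fun w => `|\sum_(a <- samples r i) X a w - N * p i|).
    apply: (measurableT_comp (@normr_measurable R setT)).
    apply: measurable_funB => //.
    by apply: measurable_sum => a; exact: measurable_funPT.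
  rewrite -[X in measurable X]setTI.
  exact: measurable_fun_le (measurable_cst _) mN.
case: model => X01 EX _ indX.
have EX' a : ('E_P[X a] = (p a.1.2)%:E)%E by case: a => [[j i'] s]; exact: EX.
have us : uniq (samples r i).
  apply: allpairs_uniq; rewrite ?enum_uniq ?iota_uniq//.
  by move=> [j s] [j' s'] _ _ /= [-> ->].
have ps a : a \in samples r i -> p a.1.2 = p i.
  by case/allpairsP => -[j s] [_ _ ->].
have := hoeffding_two_sided X01 EX' indX us ps e0.
move=> /le_trans; apply; rewrite lee_fin.
have := @budget_le_nsamples R k n delta e n_gt0 delta01 e_gt0 r.
rewrite budgetE// => tN.
have k0 : 0 < k%:R :> R by rewrite ltr0n.
(* The right side is Hoeffding's exponent for error [e r / 2]. With exactly [k] times the budget as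
   sample number it would equal the logarithm; rounding up only increases it. *)
have L : log_factor n delta r <= 2 * N * (e r / 2) ^+ 2.
  rewrite /N size_samples natrM.
  apply: (@le_trans _ _ (k%:R * e r ^+ 2 / 2 *
    (2 / (k%:R * e r ^+ 2) * log_factor n delta r))).
    by rewrite le_eqVlt; apply/orP; left; apply/eqP; field; rewrite !gt_eqF.
  apply: (@le_trans _ _ (k%:R * e r ^+ 2 / 2 * (nsamples k n delta e r)%:R)).
    by rewrite ler_wpM2l// divr_ge0// mulr_ge0// exprn_ge0// ltW.
  by rewrite le_eqVlt; apply/orP; left; apply/eqP; field.
apply: (@le_trans _ _ (2 * expR (- log_factor n delta r))).
  by rewrite ler_pM2l// ler_expR lerN2.
case/andP: delta01 => d0 _.
rewrite expRN lnK; last first.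
  by rewrite posrE !mulr_gt0 ?invr_gt0 ?exprn_gt0 ?ltr0n.
by rewrite le_eqVlt; apply/orP; left; apply/eqP; field; rewrite !gt_eqF ?ltr0n.
Qed.

Lemma accurate_with_prob (M : nat) : with_prob_ge P (1 - delta) (fun w =>
  forall r i, (0 < r <= M)%N ->
    `|pooled_mean delta e (x w) r i - p i| <= e r / 2).
Proof.
(* A finite union suffices, as the run will stop by round [M]; the index [r] stands for round
   [r.+1]. *)
pose U := \big[setU/set0]_(r < M) \big[setU/set0]_(i < n) inaccurate r.+1 i.
have mU r : measurable (\big[setU/set0]_(i < n) inaccurate r.+1 i).
  by apply: bigsetU_measurable => i _; case: (@inaccurate_le r.+1 i isT).
exists (~` U); split.
- by apply: measurableC; apply: bigsetU_measurable.
- move=> w Uw r i /andP[r0 rM]; apply/ltW; rewrite ltNge; apply/negP => bad.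
  have r1 : (r.-1 < M)%N by rewrite prednK.
  apply: Uw; rewrite /U (bigD1 (Ordinal r1))//=; left.
  by rewrite (bigD1 i)//=; left; rewrite /inaccurate/= prednK// ltW.
rewrite probability_setC; last exact: bigsetU_measurable.
rewrite EFinB leeB//.
apply: (le_trans (probability_bigsetU_le P _ (fun r : 'I_M => mU r))).
(* The [n] arms cancel the [n] in the failure probability of a round; the inverse squares sum to at
   most 2, leaving [delta]. *)
apply: (@le_trans _ _ (\sum_(r < M) (delta / 2 * r.+1%:R ^- 2)%:E)%E); last first.
  rewrite sumEFin lee_fin -mulr_sumr.
  case/andP: delta01 => d0 _.
  have := ler_wpM2l (ltW d0) (sum_inv_sqr_le2 R M); lra.
apply: lee_sum => r _.
have := probability_bigsetU_le P (index_enum 'I_n)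
  (fun i => (@inaccurate_le r.+1 i isT).1).
move=> /le_trans; apply.
apply: (@le_trans _ _ (\sum_(i < n) (delta / (2 * n%:R) * r.+1%:R ^- 2)%:E)%E).
  by apply: lee_sum => i _; exact: (@inaccurate_le r.+1 i isT).2.
rewrite sumEFin lee_fin sumr_const card_ord -[X in X <= _]mulr_natr.
rewrite le_eqVlt; apply/orP; left; apply/eqP.
have n0 : n%:R != 0 :> R by rewrite pnatr_eq0 -lt0n.
by move: (r.+1%:R ^- 2) (n%:R : R) n0 => c m m0; field.
Qed.

End accuracy.

(** * The schedule eps^(r/N) *)

Section root_schedule.
Variables (R : realType) (eps : R) (N : nat).
Hypotheses (N_gt0 : (0 < N)%N) (eps01 : 0 < eps < 1).

Let eps0 : 0 < eps. Proof. by case/andP: eps01. Qed.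
Let eps1 : eps < 1. Proof. by case/andP: eps01. Qed.
Let N0 : N%:R != 0 :> R. Proof. by rewrite pnatr_eq0 -lt0n. Qed.

Lemma root_schedule_gt0 r : 0 < root_schedule eps N r.
Proof. exact: powR_gt0. Qed.

Lemma root_schedule0 : root_schedule eps N 0 = 1.
Proof. by rewrite /root_schedule mul0r powRr0. Qed.

Lemma root_schedule_last : root_schedule eps N N = eps.
Proof. by rewrite /root_schedule divff// powRr1// ltW. Qed.

Lemma root_scheduleS r :
  root_schedule eps N r = root_schedule eps N r.+1 * eps `^ (- N%:R^-1).
Proof.
rewrite /root_schedule -powRD; last by rewrite (gt_eqF eps0) implybT.
by congr (_ `^ _); rewrite -natr1; field.
Qed.

Lemma root_schedule_ratio_ge1 : 1 <= eps `^ (- N%:R^-1).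
Proof.
rewrite -[X in X <= _](powRr0 eps); apply: ger_powR; first by rewrite eps0 ltW.
by rewrite oppr_le0 invr_ge0.
Qed.

Lemma root_schedule_ratio_sqr :
  (eps `^ (- N%:R^-1)) ^+ 2 = eps `^ (- (2 / N%:R)).
Proof.
rewrite -powR_mulrn ?powR_ge0// -powRrM; congr (_ `^ _).
by rewrite mulNr mulrC.
Qed.

(** After taking logarithms the conclusion says that [r / N * ln eps^-1] is at least
    [ln eps^-1 + ln 2]. *)
Lemma root_schedule_le_half r :
  N%:R * (1 + ln 2 / ln eps^-1) <= r%:R -> root_schedule eps N r <= eps / 2.
Proof.
move=> h.
have l0 : 0 < ln eps^-1 by rewrite ln_gt0// invf_gt1.
have Np : 0 < N%:R :> R by rewrite ltr0n.
rewrite -ler_ln ?posrE ?divr_gt0 ?root_schedule_gt0//.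
rewrite /root_schedule ln_powR ln_div ?posrE//.
have -> : ln eps = - ln eps^-1 by rewrite lnV ?posrE// opprK.
move: (ln eps^-1) (ln 2) l0 h => l t l0 h.
rewrite mulrN -opprD lerN2 mulrAC ler_pdivlMr//.
rewrite [X in X <= _](_ : _ = N%:R * (1 + t / l) * l).
  by rewrite ler_wpM2r// ltW.
by field; rewrite gt_eqF.
Qed.

End root_schedule.

(** * Combining the probabilistic and deterministic parts *)

Section assembly.
Context (dT : measure_display) (T : measurableType dT) (R : realType)
  (P : probability T R).
Variables (N k n : nat) (eps delta : R) (p : 'I_n -> R) (a1 : 'I_n)
  (X : 'I_k * 'I_n * nat -> {RV P >-> R}).
Hypotheses (N_gt0 : (0 < N)%N) (k_gt0 : (0 < k)%N) (n_gt1 : (1 < n)%N).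
Hypotheses (eps01 : 0 < eps < 1) (delta01 : 0 < delta < 1).
Hypotheses (p_a1 : forall i, p i <= p a1) (model : reward_model p X).

Let x (w : T) (j : 'I_k) (i : 'I_n) (s : nat) : R := X (j, i, s) w.
Let e := root_schedule eps N.

(** Serves both stopping rules: [M] is a fixed round by which the schedule has reached [theta], and
    accuracy is required up to [M] only. *)
Lemma good_run_with_prob (theta rounds : R) (M : nat)
    (ret : {set 'I_n} -> ('I_n -> R) -> 'I_n) :
  (0 < M)%N -> M%:R <= rounds -> eps / 2 <= theta -> e M <= theta ->
  (theta = eps /\ returns_top_survivor ret \/
   theta = eps / 2 /\ returns_survivor ret) ->
  with_prob_ge P (1 - delta) (fun w => good_run p a1 eps delta e theta ret rounds
    ((1 + ln rounds) * polylog 64 1 k n eps delta * complexity k p a1 eps N)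
    (x w)).
Proof.
move=> M_gt0 Mr theta_ge eM hret.
have n_gt0 : (0 < n)%N by exact: ltnW.
have e_gt0 r : 0 < e r by exact: root_schedule_gt0.
pose rho := eps `^ (- N%:R^-1).
have rho1 : 1 <= rho by exact: root_schedule_ratio_ge1.
have eS r : e r = e r.+1 * rho by exact: root_scheduleS.
have e0 : e 0%N = 1 by exact: root_schedule0.
have e_noninc r : e r.+1 <= e r by rewrite [leRHS]eS ler_peMr// ltW.
case: (model) => X01 EX _ _.
have x_ge0 w j i s : 0 <= x w j i s by case/andP: (X01 (j, i, s) w).
have p01 i : 0 <= p i <= 1.
  have EX' a : ('E_P[X a] = (p a.1.2)%:E)%E by case: a => [[j i'] s]; exact: EX.
  pose a : 'I_k * 'I_n * nat := (Ordinal k_gt0, i, 0%N).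
  by rewrite (mean_ge0 X01 EX' a) (mean_le1 X01 EX' a).
have [A [mA Aacc PA]] :=
  accurate_with_prob model k_gt0 n_gt0 delta01 e_gt0 M.
exists A; split=> // w /Aacc acc.
have [r r_stop rM] := stops_within delta (x w) M_gt0 eM.
exists r.
have r_gt0 : (0 < r)%N by case: r_stop.
have rr : r%:R <= rounds by rewrite (le_trans _ Mr)// ler_nat.
have pulls := pulls_le k_gt0 n_gt1 delta01 eps01 e_gt0 e0 rho1 eS p01 p_a1
  (x_ge0 w) acc theta_ge r_stop rM.
have compl : rho ^+ 2 / k%:R * \sum_(i < n | i != a1) (eps_gap p a1 eps i) ^- 2 =
    complexity k p a1 eps N by rewrite /complexity -root_schedule_ratio_sqr.
have compl_ge0 : 0 <= complexity k p a1 eps N.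
  rewrite /complexity mulr_ge0 ?divr_ge0 ?powR_ge0// sumr_ge0// => i _.
  by rewrite invr_ge0 exprn_ge0// le_max (ltW (proj1 (andP eps01))) orbT.
have L0 : 0 <= log_factor n delta r :> R by exact: log_factor_ge0.
have bound : 32 * log_factor n delta r * complexity k p a1 eps N <=
    (1 + ln rounds) * polylog 64 1 k n eps delta * complexity k p a1 eps N.
  by rewrite ler_wpM2r// log_factor_bound.
split=> //.
- case: hret => -[thE hret].
    exact: (top_survivor_eps_best eps01 e_gt0 p_a1 (x_ge0 w) acc r_stop).
  exact: (survivor_eps_best eps01 e_gt0 p_a1 (x_ge0 w) acc r_stop).
(* In general rounding up adds at most one pull to each budget. *)
- have := pulls 1 1 ler01 ler01; rewrite compl !mul1r => /(_ _)/le_trans; apply.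
    by move=> q _; rewrite mul1r; exact: nsamples_le_budget.
  rewrite lerD2r (le_trans _ bound)// ler_wpM2r// ler_wpM2r//; lra.
(* If the first budget is at least 1, so are all later ones, and rounding up at most doubles
   them. *)
move=> t1; have := pulls 0 2 (lexx 0) (ler0n R 2); rewrite compl mul0r addr0.
move=> /(_ _)/le_trans; apply; last by rewrite mulrA -natrM.
move=> q q_gt0; have t1q : 1 <= budget k n delta e q.
  case: q q_gt0 => // q _; apply: (le_trans t1).
  elim: q => // q IH; apply: (le_trans IH).
  exact: budget_le.
rewrite addr0; have := @nsamples_le_budget R k n delta e n_gt0 delta01 e_gt0 q.
lra.
Qed.

End assembly.

Theorem corollary4p2 (R : realType) :
  exists (C : R) (d : nat), 0 < C /\
  forall (N k n : nat) (eps delta : R) (p : 'I_n -> R) (a1 : 'I_n)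
    (dT : measure_display) (T : measurableType dT) (P : probability T R)
    (X : 'I_k * 'I_n * nat -> {RV P >-> R}),
    (0 < N)%N -> (0 < k)%N -> (1 < n)%N ->
    0 < eps < 1 -> 0 < delta < 1 ->
    a1 = 0%N :> nat ->
    (forall i j : 'I_n, (i <= j)%N -> p j <= p i) ->
    reward_model p X ->
    let x (w : T) (j : 'I_k) (i : 'I_n) (s : nat) : R := X (j, i, s) w in
    let e : nat -> R := root_schedule eps N in
    let pulls (rounds : R) : R :=
      (1 + ln rounds) * polylog C d k n eps delta * complexity k p a1 eps N in
    (* Stopping at accuracy eps: at most N rounds. *)
    (forall ret : {set 'I_n} -> ('I_n -> R) -> 'I_n,
       returns_top_survivor ret ->
       with_prob_ge P (1 - delta) (fun w : T =>
         good_run p a1 eps delta e eps ret N%:R (pulls N%:R) (x w)))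
    /\
    (* Stopping at accuracy eps / 2, as for the schedule 2^-r: at most the
       number of rounds after which eps^(r/N) is below eps / 2. *)
    (forall (ret : {set 'I_n} -> ('I_n -> R) -> 'I_n) (rounds : R),
       returns_survivor ret ->
       rounds = (Num.ceil (N%:R * (1 + ln 2 / ln eps^-1)))%:~R ->
       with_prob_ge P (1 - delta) (fun w : T =>
         good_run p a1 eps delta e (eps / 2) ret rounds (pulls rounds) (x w))).
Proof.


(* Both constants come from [log_factor_bound]. *)
exists 64, 1%N; split=> // N k n eps delta p a1 dT T P X N0 k0 n1 eps01 delta01.
move=> a10 p_sorted model x e pulls.
have p_a1 i : p i <= p a1 by apply: p_sorted; rewrite a10.
have /andP[eps0 eps1] := eps01.
split=> [ret hret|ret rounds hret roundsE].
  (* Here [M = N], because the schedule takes the value [eps] at round [N]. *)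
  apply: (good_run_with_prob N0 k0 n1 eps01 delta01 p_a1 model N0) => //.
  - lra.
  - by rewrite root_schedule_last.
  - by left.
(* Positivity makes the ceiling a positive natural number, which then serves as [M]. *)
have y_gt0 : 0 < N%:R * (1 + ln 2 / ln eps^-1) :> R.
  rewrite mulr_gt0 ?ltr0n// addr_gt0// divr_gt0// ln_gt0 ?invf_gt1//.
  by rewrite ltr1n.
have M_gt0 : (0 < `|Num.ceil (N%:R * (1 + ln 2 / ln eps^-1) : R)|)%N.
  by rewrite absz_gt0 gt_eqF// ceil_gt0.
have ME : `|Num.ceil (N%:R * (1 + ln 2 / ln eps^-1) : R)|%:R = rounds.
  by rewrite roundsE natr_absz gtr0_norm// ceil_gt0.
apply: (good_run_with_prob N0 k0 n1 eps01 delta01 p_a1 model M_gt0) => //.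
- by rewrite ME.
- by apply: root_schedule_le_half => //; rewrite ME roundsE ceil_ge.
- by right.
Qed.
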